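(* Let $n \in \mathbb{N}$, let $S$ be a commutative semiring, and let $T$ be a submonoid of $(S,\cdot)$. Let $\mathcal{X}$ be a semigroup generating set for the group of units of the monoid $UT_n^T(S)$, and let $\Omega,\Theta \subseteq S$ be such that $U(T)(\Omega \cup V(S))$ generates $(S,+)$ and $\Theta \cup U(T)$ generates $(T,\cdot)$. Then the monoid $UT_n^T(S)$ is generated by $\mathcal{X} \cup E(\Omega) \cup A(\Theta)$, where $$A(\Theta) = \{A_i(\theta) : \theta \in \Theta,\ 1 \le i \le n\}, \qquad E(\Omega) = \{E_{ij}(\omega) : \omega \in \Omega,\ 1 \le i < j \le n\}.$$ Moreover, if $\mathcal{X}$, $\Omega$ and $\Theta$ are minimal (resp. irredundant) with the properties just required of them, then $UT_n^T(S)$ is minimally (resp. irredundantly) generated by $\mathcal{X} \cup E(\Omega) \cup A(\Theta)$.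
   Context: $\mathbb{N}$ is the set of positive integers. A semiring $S$ is a set with two operations $+,\cdot$ such that $(S,+)$ is a commutative monoid with identity $0_S$, $(S,\cdot)$ is a monoid with identity $1_S$, multiplication distributes over addition on both sides, and $x0_S = 0_Sx = 0_S$ for all $x$; it is commutative if $(S,\cdot)$ is commutative. $U(T)$ is the group of units of the monoid $(T,\cdot)$. $V(S)$ is the set of additively invertible elements of $S$, i.e. those $x$ for which there is $y \in S$ with $x+y=0_S$. For subsets $P,Q\subseteq S$, $PQ=\{pq : p\in P, q\in Q\}$. $UT_n(S)$ is the monoid, under matrix multiplication, of $n\times n$ upper triangular matrices over $S$ (all entries below the diagonal equal $0_S$), and $UT_n^T(S)$ is its submonoid of matrices all of whose diagonal entries lie in $T$. $A_i(\lambda)$ is the $n \times n$ diagonal matrix with $\lambda$ in position $(i,i)$ and $1_S$ in all other diagonal positions. For $i<j$, $E_{ij}(\lambda)$ is the $n\times n$ matrix with all diagonal entries $1_S$, $(i,j)$ entry $\lambda$, and all other entries $0_S$. A subset $X$ of a semigroup $\mathcal{S}$ generates $\mathcal{S}$ if $\mathcal{S}$ is the smallest subsemigroup of $\mathcal{S}$ containing $X$. A generating set $X$ is minimal if $|X| \le |Y|$ for every generating set $Y$, and irredundant if $X\setminus\{x\}$ is not a generating set for every $x \in X$. More generally, a set is minimal with a given property if it has the property and its cardinality is at most that of any set having the property; it is irredundant with a given property if it has the property and no proper subset of it does. Here $\mathcal{X}$ is considered with the property of being a semigroup generating set of the group of units of $UT_n^T(S)$, $\Omega\subseteq S$ with the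 property that $U(T)(\Omega\cup V(S))$ generates $(S,+)$, and $\Theta \subseteq S$ with the property that $\Theta\cup U(T)$ generates $(T,\cdot)$. ''Minimally (resp. irredundantly) generated by $X$'' means $X$ is a minimal (resp. irredundant) generating set. *)

(* Defs.v *)
From HB Require Import structures.
From mathcomp Require Import all_boot all_order all_algebra.
From mathcomp Require Import boolp classical_sets functions cardinality.

Set Implicit Arguments.
Unset Strict Implicit.
Unset Printing Implicit Defensive.

Import GRing.Theory.

Local Open Scope classical_set_scope.
Local Open Scope ring_scope.

Section Semigroups.
Variables (M : Type) (op : M -> M -> M).

Definition subsemigroup (A : set M) : Prop :=
  forall x y, A x -> A y -> A (op x y).

(* [smallest] is the intersection of all subsemigroups of the ambient type
   containing [X].  When [G] is itself a subsemigroup, this equation forces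
   [X `<=` G] and says that [G] is the least subsemigroup of [G] containing
   [X].  The empty set is allowed as a subsemigroup. *)
Definition generates (G X : set M) : Prop := smallest subsemigroup X = G.

Definition units (e : M) (G : set M) : set M :=
  [set x | G x /\ exists y, [/\ G y, op x y = e & op y x = e]].

Definition irredundant_generating (G X : set M) : Prop :=
  generates G X /\ forall x, X x -> ~ generates G (X `\ x).

End Semigroups.

Section MinimalIrredundant.
Variables (M : Type) (P : set M -> Prop).

Definition minimal_with (X : set M) : Prop :=
  P X /\ forall Y, P Y -> (X #<= Y)%card.

Definition irredundant_with (X : set M) : Prop :=
  P X /\ forall Y, Y `<` X -> ~ P Y.

End MinimalIrredundant.

Definition minimal_generating (M : Type) (op : M -> M -> M) (G : set M) :
  set M -> Prop := minimal_with (generates op G).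

Section Semirings.
Variable S : comPzSemiRingType.

Definition submonoid (T : set S) : Prop := T 1 /\ subsemigroup *%R T.

Definition U (T : set S) : set S := units *%R 1 T.

Definition V : set S := [set x | exists y, x + y = 0].

Definition setmul (P Q : set S) : set S := [set p * q | p in P & q in Q].

Definition Omega_generates (T Omega : set S) : Prop :=
  generates +%R [set: S] (setmul (U T) (Omega `|` V)).

Definition Theta_generates (T Theta : set S) : Prop :=
  generates *%R T (Theta `|` U T).

Variable n : nat.

Definition UT : set 'M[S]_n :=
  [set A | forall i j : 'I_n, (j < i)%N -> A i j = 0].

Definition UTT (T : set S) : set 'M[S]_n :=
  [set A | UT A /\ forall i, T (A i i)].

Definition UTT_units (T : set S) : set 'M[S]_n := units mulmx 1%:M (UTT T).

Definition Amx (i : 'I_n) (l : S) : 'M[S]_n :=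
  diag_mx (\row_j if j == i then l else 1).

Definition Emx (i j : 'I_n) (l : S) : 'M[S]_n :=
  \matrix_(p, q) if p == q then 1 else if (p == i) && (q == j) then l else 0.

Definition Aset (Theta : set S) : set 'M[S]_n :=
  [set A | exists (i : 'I_n) (t : S), Theta t /\ A = Amx i t].

Definition Eset (Omega : set S) : set 'M[S]_n :=
  [set A | exists (i j : 'I_n) (w : S), [/\ (i < j)%N, Omega w & A = Emx i j w]].

End Semirings.

Arguments V {S}.
Arguments UT {S n}.
Arguments UTT {S n} T.
Arguments UTT_units {S n} T.
Arguments Aset {S n} Theta.
Arguments Eset {S n} Omega.

(* Main.v *)
Require Import Defs.
From mathcomp Require Import all_boot all_order all_algebra.
From mathcomp Require Import boolp classical_sets functions cardinality.

(** Throughout, UTT denotes the monoid of upper triangular matrices over [S]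
    with diagonal in [T]; its elements are products of elementary matrices.

    Generation.  A triangular matrix can be built from the identity by column
    operations, treating the columns from right to left, so any semigroup that
    contains the identity and the elementary matrices formed from the entries
    of [A] contains [A] ([elementary_factorisation]).  Since [t |-> Amx i t] is
    multiplicative, [s |-> Emx i j s] turns sums into products, and conjugating
    by a diagonal unit [Amx i u] turns [Emx i j w] into [Emx i j (u * w)], the
    elementary matrices all come from the proposed generators
    ([UTT_generates]).

    Lower bounds.  The key notion is that of a face: a set [F] such that a
    product lies in [F] only if both factors do.  An element of a face is a
    product of generators from that same face ([face_ind]).  Because [U T] is a
    face of [T], and a sum lies in [V] only if all its summands do, prescribing
    a unit diagonal and off-diagonal entries in [V], everywhere or with one
    exception, defines faces of UTT ([face_unit_at]).  With no exception the
    face is the group of units ([UTT_unitsE]).  Let [Y] generate UTT.  The units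
    in [Y] generate the group of units.  The members of [Y] whose only non-unit
    diagonal entry is at the place [i] have at [i] entries that, with [U T],
    generate [T], because [Amx i t] lies in the corresponding face.  Those with
    unit diagonal and a single entry outside [V], at [(i, j)], have there
    entries that suffice to generate [S] additively, because [Emx i j s] lies
    in the corresponding face.

    These parts of [Y] are pairwise disjoint, one for each of the families
    [X], [Amx i @` Theta], [Emx i j @` Omega], and each is at least as large as
    its family when [X], [Omega], [Theta] are minimal.  This gives minimality,
    for infinite cardinals too.  For irredundance, apply the same three facts
    to the proposed generators with one removed: irredundance of [Omega] and
    [Theta] excludes elements of [V] and of [U T], so each part is contained in
    the matching family, and the removed element makes that inclusion strict. *)

Set Implicit Arguments.
Unset Strict Implicit.
Unset Printing Implicit Defensive.

Import GRing.Theory.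

Local Open Scope classical_set_scope.
Local Open Scope ring_scope.

(** * Generating sets of semigroups *)

Section Generation.
Variables (M : Type) (op : M -> M -> M).
Implicit Types (X Y G F : set M).

Lemma subsemigroup_smallest X : subsemigroup op (smallest (subsemigroup op) X).
Proof. by move=> x y xX yX G sub_G; apply: sub_G.1; [exact: xX|exact: yX]. Qed.

Lemma generates_subset G X : generates op G X -> X `<=` G.
Proof. by move=> <-; exact: sub_gen_smallest. Qed.

Lemma generates_subsemigroup G X : generates op G X -> subsemigroup op G.
Proof. by move=> <-; exact: subsemigroup_smallest. Qed.

Lemma generatesP G X : subsemigroup op G -> X `<=` G ->
  (forall H, subsemigroup op H -> X `<=` H -> G `<=` H) -> generates op G X.
Proof.
move=> subG XG least; apply/seteqP; split; first exact: smallest_sub.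
apply: least; [exact: subsemigroup_smallest | exact: sub_gen_smallest].
Qed.

Lemma generates_sub G X H : generates op G X -> subsemigroup op H ->
  X `<=` H -> G `<=` H.
Proof. by move=> <-; exact: smallest_sub. Qed.

(** The complement of [F] in [G] is an ideal of [G]. *)
Definition face G F : Prop :=
  forall x y, G x -> G y -> F (op x y) -> F x /\ F y.

(** Membership in a face passes from a product to its factors, so a
    factorisation of an element of [F] into members of [X] only involves
    members of [X `&` F]. *)
Lemma face_ind G F X (P : M -> Prop) : generates op G X -> face G F ->
  (forall x, X x -> F x -> P x) ->
  (forall x y, G x -> G y -> F x -> F y -> P x -> P y -> P (op x y)) ->
  forall x, G x -> F x -> P x.
Proof.
move=> genX faceF PX Pop x Gx.
have subG := generates_subsemigroup genX.
suff: G `<=` [set x | G x /\ (F x -> P x)] by move=> /(_ x Gx)[].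
apply: (generates_sub genX) => [a b [Ga Pa] [Gb Pb]|a Xa] /=; last first.
  by split; [exact: (generates_subset genX) | exact: PX].
split=> [|Fab]; first exact: subG.
have [Fa Fb] := faceF _ _ Ga Gb Fab.
by apply: Pop => //; [exact: Pa | exact: Pb].
Qed.

End Generation.

(** * Cardinality of a union over disjoint pieces *)

(** An injection on each piece glues to one on the union because the targets
    are disjoint.  It is easier to glue surjections in the other direction: a
    point of the target then determines which of them to apply. *)
Lemma card_le_bigcup (M N I : Type) (D : set I) (Z : I -> set M)
    (Y : I -> set N) : trivIset D Y ->
  (forall k, D k -> (Z k #<= Y k)%card) ->
  (\bigcup_(k in D) Z k #<= \bigcup_(k in D) Y k)%card.
Proof.
elim/Ppointed: M => M in Z *; first by rewrite emptyE.
move=> trivY leZY.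
have exg k : exists g : N -> M, D k -> Z k `<=` g @` Y k.
  case: (pselect (D k)) => [Dk|//]; last by exists (fun=> point).
  by have /pcard_surjP[g gP] := leZY k Dk; exists g.
have [g gP] := choice exg.
pose h y := if pselect (exists k, D k /\ Y k y) is left e
            then g (projT1 (cid e)) y else point.
suff sub : \bigcup_(k in D) Z k `<=` h @` (\bigcup_(k in D) Y k).
  exact: card_le_trans (subset_card_le sub) (card_image_le _ _).
move=> z [k Dk /(gP k Dk)[y Yky <-]]; exists y; first by exists k.
rewrite /h; case: pselect => [e|[]]; last by exists k.
case: (cid e) => l /= [Dl Yly]; congr (g _ y).
by apply: trivY => //; exists y.
Qed.

(** * Additively invertible elements and units *)

Section Scalars.
Variables (S : comPzSemiRingType) (T : set S).
Hypothesis T_submonoid : submonoid T.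
Implicit Types x y : S.

Lemma V0 : V (0 : S).
Proof. by exists 0; rewrite addr0. Qed.

Lemma V_add x y : V x -> V y -> V (x + y).
Proof.
by move=> [x' xx'] [y' yy']; exists (x' + y'); rewrite addrACA xx' yy' addr0.
Qed.

Lemma V_addl x y : V (x + y) -> V x.
Proof. by move=> [z xyz]; exists (y + z); rewrite addrA. Qed.

Lemma V_mull x y : V y -> V (x * y).
Proof. by move=> [z yz]; exists (x * z); rewrite -mulrDr yz mulr0. Qed.

Lemma V_mulr x y : V x -> V (x * y).
Proof. by rewrite mulrC; exact: V_mull. Qed.

Lemma V_sum (I : finType) (P : pred I) (f : I -> S) :
  (forall i, P i -> V (f i)) -> V (\sum_(i | P i) f i).
Proof. by move=> Vf; apply: big_ind => //; [exact: V0 | exact: V_add]. Qed.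

Lemma V_term (I : finType) (f : I -> S) : V (\sum_i f i) -> forall i, V (f i).
Proof. by move=> + i; rewrite (bigD1 i) //=; exact: V_addl. Qed.

Lemma V_unitl u x : U T u -> V (u * x) -> V x.
Proof.
move=> [_ [v [_ _ vu]]] Vux; rewrite -[x]mul1r -vu -mulrA; exact: V_mull.
Qed.

Lemma V_unitr u x : U T u -> V (x * u) -> V x.
Proof. by rewrite mulrC; exact: V_unitl. Qed.

Lemma U1 : U T 1.
Proof.
have T1 := T_submonoid.1; split=> //.
by exists 1; rewrite mulr1.
Qed.

Lemma U_mul u v : U T u -> U T v -> U T (u * v).
Proof.
move=> [Tu [u' [Tu' uu' _]]] [Tv [v' [Tv' vv' _]]].
have TM := T_submonoid.2; split; first exact: TM.
exists (u' * v'); split; first exact: TM.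
  by rewrite mulrACA uu' vv' mulr1.
by rewrite mulrC mulrACA uu' vv' mulr1.
Qed.

Lemma U_mull u v : T u -> T v -> U T (u * v) -> U T u.
Proof.
move=> Tu Tv [_ [w [Tw uvw _]]]; split=> //.
have uvw' : u * (v * w) = 1 by rewrite mulrA.
by exists (v * w); split; [exact: T_submonoid.2 | | rewrite mulrC].
Qed.

(** Commutativity makes a factor of a unit of [T] a unit of [T]. *)
Lemma U_face : face *%R T (U T).
Proof.
move=> u v Tu Tv Uuv; split; first exact: U_mull Uuv.
by rewrite mulrC in Uuv; exact: U_mull Uuv.
Qed.

End Scalars.

(** * Upper triangular matrices *)

Section Triangular.
Variables (n : nat) (S : comPzSemiRingType) (T : set S).
Hypothesis T_submonoid : submonoid T.
Implicit Types (A B : 'M[S]_n) (i j p q : 'I_n).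

Lemma AmxE i (t : S) p q :
  Amx i t p q = if p == q then (if p == i then t else 1) else 0.
Proof. by rewrite /Amx !mxE; case: (eqVneq p q) => [->|]. Qed.

Lemma EmxE i j (s : S) p q : Emx i j s p q =
  if p == q then 1 else if (p == i) && (q == j) then s else 0.
Proof. by rewrite mxE. Qed.

Lemma mulmx_Amx A i t p q : (A *m Amx i t) p q =
  if q == i then A p q * t else A p q.
Proof.
rewrite mxE (bigD1 q) //= AmxE eqxx big1 => [|r /negPf rq].
  by rewrite addr0; case: (q == i); rewrite ?mulr1.
by rewrite AmxE rq mulr0.
Qed.

Lemma mulmx_Emx A i j s p q : i != j -> (A *m Emx i j s) p q =
  if q == j then A p j + A p i * s else A p q.
Proof.
move=> ij; rewrite mxE (bigD1 q) //= EmxE eqxx mulr1.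
case: (eqVneq q j) => [-> {q}|qj]; last first.
  rewrite big1 ?addr0 // => r /negPf rq.
  by rewrite EmxE rq (negPf qj) andbF mulr0.
rewrite (bigD1 i) //= EmxE (negPf ij) !eqxx /= big1 ?addr0 //.
by move=> r /andP[/negPf rj /negPf ri]; rewrite EmxE rj ri mulr0.
Qed.

Lemma mulmx_diag A B i : UT A -> UT B -> (A *m B) i i = A i i * B i i.
Proof.
move=> UTA UTB; rewrite mxE (bigD1 i) //= big1 ?addr0 // => k ki.
have [lt_ki|lt_ik|/val_inj kE] := ltngtP k i; last by rewrite kE eqxx in ki.
- by rewrite UTA // mul0r.
- by rewrite UTB // mulr0.
Qed.

Lemma UTT_subsemigroup : subsemigroup mulmx (@UTT S n T).
Proof.
move=> A B [UTA TA] [UTB TB]; split=> [i j ji|i]; last first.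
  by rewrite mulmx_diag //; exact: T_submonoid.2.
rewrite mxE big1 // => k _; have [jk|kj] := leqP i k.
  by rewrite UTB ?mulr0 //; exact: leq_trans ji jk.
by rewrite UTA ?mul0r.
Qed.

Lemma Amx_UTT i t : T t -> UTT T (Amx i t : 'M[S]_n).
Proof.
move=> Tt; split=> [p q qp|p]; rewrite AmxE ?eqxx.
  by rewrite -val_eqE gtn_eqF.
by case: ifP => // _; exact: T_submonoid.1.
Qed.

Lemma Emx_UTT i j s : (i < j)%N -> UTT T (Emx i j s : 'M[S]_n).
Proof.
move=> ij; split=> [p q qp|p]; rewrite EmxE ?eqxx; last exact: T_submonoid.1.
rewrite -val_eqE gtn_eqF //; case: eqP => //= pi; case: eqP => //= qj.
by move: qp; rewrite pi qj ltnNge (ltnW ij).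
Qed.

Lemma scalar1_UTT : UTT T (1%:M : 'M[S]_n).
Proof.
split=> [p q qp|p]; rewrite mxE ?eqxx; last exact: T_submonoid.1.
by rewrite -val_eqE gtn_eqF.
Qed.

Lemma AmxM i t t' : Amx i (t * t') = Amx i t *m Amx i t' :> 'M[S]_n.
Proof.
apply/matrixP => p q; rewrite mulmx_Amx !AmxE.
by case: (eqVneq p q) => [->|]; case: (q == i); rewrite ?mul0r.
Qed.

Lemma Amx1 i : Amx i 1 = 1%:M :> 'M[S]_n.
Proof. by apply/matrixP => p q; rewrite AmxE mxE if_same; case: eqP. Qed.

Lemma EmxD i j s s' : (i < j)%N ->
  Emx i j (s + s') = Emx i j s *m Emx i j s' :> 'M[S]_n.
Proof.
move=> ij; have neij : i != j by rewrite -val_eqE ltn_eqF.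
apply/matrixP => p q; rewrite mulmx_Emx // !EmxE eqxx.
case: (eqVneq q j) => [->|qj]; last by rewrite andbF.
rewrite (negPf neij) !andbT andbF.
case: (eqVneq p j) => [->|pj].
  by rewrite eq_sym (negPf neij) mul0r addr0.
by case: (p == i); rewrite ?mul1r // mul0r addr0.
Qed.

Lemma Emx0 i j : Emx i j 0 = 1%:M :> 'M[S]_n.
Proof. by apply/matrixP => p q; rewrite EmxE mxE if_same; case: eqP. Qed.

Lemma conj_Emx i j u v s : (i < j)%N -> u * v = 1 ->
  Amx i u *m Emx i j s *m Amx i v = Emx i j (u * s) :> 'M[S]_n.
Proof.
move=> ij uv; have neij : i != j by rewrite -val_eqE ltn_eqF.
apply/matrixP => p q; rewrite mulmx_Amx mulmx_Emx // !EmxE !AmxE.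
case: (eqVneq q j) => [->|qj].
  rewrite [j == i]eq_sym (negPf neij) andbT.
  case: (eqVneq p j) => [->|pj].
    by rewrite eq_sym (negPf neij) mul0r addr0.
  by case: (p == i); rewrite ?add0r // mul0r.
rewrite andbF; case: (eqVneq p q) => [->|pq]; last by rewrite mul0r if_same.
by case: (q == i).
Qed.

(** * Elementary factorisation *)

(** Multiplying on the right by [Amx c t] scales column [c], and multiplying by
    [Emx i c s] adds [s] times column [i] to column [c].  Columns are completed
    from right to left so that column [i] is still the [i]-th unit vector when
    it is used for a column [c > i].  Membership in [G] is required only for the
    entries of [A], so that the lemma serves for the group of units as well as
    for the whole monoid. *)
Lemma elementary_factorisation (G : set 'M[S]_n) A :
  subsemigroup mulmx G -> G 1%:M -> UT A ->
  (forall i, G (Amx i (A i i))) ->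
  (forall i j, (i < j)%N -> G (Emx i j (A i j))) -> G A.
Proof.
move=> subG G1 UTA GA GE.
(* [P c] is [A] with its columns before [c] replaced by those of the
   identity; [Q c k] differs from it in column [c], where only the diagonal
   entry and the entries in rows before [k] are in place. *)
pose P c : 'M[S]_n := \matrix_(p, q) if (q < c)%N then (p == q)%:R else A p q.
pose Q (c : 'I_n) k : 'M[S]_n := \matrix_(p, q)
  if (q < c)%N then (p == q)%:R
  else if q == c then (if (p < k)%N || (p == c) then A p q else 0) else A p q.
have P_last : P n = 1%:M by apply/matrixP => p q; rewrite !mxE ltn_ord.
have Q_first c : Q c 0%N = P c.+1 *m Amx c (A c c).
  apply/matrixP => p q; rewrite mulmx_Amx !mxE ltn0 /= ltnS.
  case: (eqVneq q c) => [->|qc]; last by rewrite ltn_neqAle qc.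
  by rewrite ltnn leqnn; case: eqVneq => [->|_]; rewrite ?mul1r // mul0r.
have Q_next (i c : 'I_n) : (i < c)%N -> Q c i.+1 = Q c i *m Emx i c (A i c).
  move=> ic; have neic : i != c by rewrite -val_eqE ltn_eqF.
  apply/matrixP => p q; rewrite mulmx_Emx // !mxE ltnS.
  case: (eqVneq q c) => [->|//]; rewrite ltnn eqxx ic leq_eqVlt val_eqE.
  case: (eqVneq p i) => [->|_]; last by rewrite mul0r addr0.
  by rewrite ltnn (negPf neic) add0r mul1r.
have Q_last c : Q c c = P c.
  apply/matrixP => p q; rewrite !mxE; case: ltnP => // _.
  case: (eqVneq q c) => [->|//]; case: ltngtP => [//|cp|/val_inj->].
    by rewrite -val_eqE gtn_eqF // UTA.
  by rewrite eqxx.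
have G_Q (c : 'I_n) k : G (P c.+1) -> (k <= c)%N -> G (Q c k).
  move=> GP; elim: k => [_|k IHk kc]; first by rewrite Q_first; exact: subG.
  have kn : (k < n)%N := ltn_trans kc (ltn_ord c).
  rewrite (Q_next (Ordinal kn)) //; apply: subG; last exact: GE.
  by apply: IHk; exact: ltnW.
have G_P d : (d <= n)%N -> G (P (n - d)%N).
  elim: d => [_|d IHd dn]; first by rewrite subn0 P_last.
  have cn : (n - d.+1 < n)%N by rewrite ltn_subrL (leq_trans _ dn).
  rewrite -[(n - d.+1)%N]/(nat_of_ord (Ordinal cn)) -Q_last; apply: G_Q => //=.
  by rewrite subnSK //; apply: IHd; exact: ltnW.
suff -> : A = P 0%N by rewrite -(subnn n); exact: G_P.
by apply/matrixP => p q; rewrite mxE.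
Qed.

(** * The group of units and the faces of the triangular monoid *)

Lemma UTT_units_subsemigroup : subsemigroup mulmx (@UTT_units S n T).
Proof.
move=> A B [TA [A' [TA' AA' A'A]]] [TB [B' [TB' BB' B'B]]].
split; first exact: UTT_subsemigroup.
exists (B' *m A'); split; first exact: UTT_subsemigroup.
  by rewrite mulmxA -(mulmxA A) BB' mulmx1.
by rewrite mulmxA -(mulmxA B') A'A mulmx1.
Qed.

Lemma scalar1_units : UTT_units T (1%:M : 'M[S]_n).
Proof.
have T1 := scalar1_UTT; split=> //.
by exists 1%:M; rewrite mulmx1.
Qed.

Lemma Amx_units i u : U T u -> UTT_units T (Amx i u : 'M[S]_n).
Proof.
move=> [Tu [v [Tv uv vu]]]; split; first exact: Amx_UTT.
by exists (Amx i v); rewrite -!AmxM uv vu Amx1; split=> //; exact: Amx_UTT.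
Qed.

Lemma Emx_units i j v : (i < j)%N -> V v -> UTT_units T (Emx i j v : 'M[S]_n).
Proof.
move=> ij [w vw]; split; first exact: Emx_UTT.
exists (Emx i j w); rewrite -!EmxD // [w + v]addrC vw Emx0.
by split=> //; exact: Emx_UTT.
Qed.

(** The matrices that look like units at the diagonal places in [D] and the
    off-diagonal places in [R]. *)
Definition unit_at (D : set 'I_n) (R : 'I_n -> 'I_n -> Prop) : set 'M[S]_n :=
  [set A | (forall i, D i -> U T (A i i)) /\
           (forall p q, (p < q)%N -> R p q -> V (A p q))].

(** A diagonal entry of a product is the product of the diagonal entries, so
    [U_face] applies.  The [(p, q)] entry of [A *m B] has among its summands
    [A p q * B q q] and [A p p * B p q]; if the sum lies in [V] so do these, and
    the diagonal factor can be cancelled once it is known to be a unit, whence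
    the condition that [R] is empty unless [D] is full. *)
Lemma face_unit_at D R : (forall p q, R p q -> forall i, D i) ->
  face mulmx (UTT T) (unit_at D R).
Proof.
move=> RD A B [UTA TA] [UTB TB] [UAB VAB].
have UD i : D i -> U T (A i i) /\ U T (B i i).
  by move=> Di; apply: U_face => //; rewrite -mulmx_diag //; exact: UAB.
split; split=> [i /UD[]//|p q pq Rpq].
  have := VAB p q pq Rpq; rewrite mxE => /V_term /(_ q).
  exact: V_unitr (UD q (RD _ _ Rpq q)).2.
have := VAB p q pq Rpq; rewrite mxE => /V_term /(_ p).
exact: V_unitl (UD p (RD _ _ Rpq p)).1.
Qed.

Definition all_rel : 'I_n -> 'I_n -> Prop := fun _ _ => True.

(** A unit divides the identity, which lies in the face on the right.
    Conversely, such a matrix is a product of elementary matrices that are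
    themselves invertible. *)
Lemma UTT_unitsE : UTT_units T = UTT T `&` unit_at setT all_rel.
Proof.
apply/seteqP; split=> [A [TA [B [TB AB _]]]|A [TA [UA VA]]].
  split=> //; have := @face_unit_at setT all_rel (fun _ _ _ _ => I) A B TA TB.
  rewrite AB => -[] //; split=> [i _|p q pq _]; rewrite mxE ?eqxx.
    exact: U1.
  by rewrite -val_eqE ltn_eqF //; exact: V0.
apply: elementary_factorisation => [||||i j ij].
- exact: UTT_units_subsemigroup.
- exact: scalar1_units.
- exact: TA.1.
- by move=> i; apply: Amx_units; exact: UA.
- by apply: Emx_units => //; exact: VA.
Qed.

Lemma unit_diag A i : UTT_units T A -> U T (A i i).
Proof. by rewrite UTT_unitsE => -[_ [UA _]]; exact: UA. Qed.

Lemma unit_off A i j : UTT_units T A -> (i < j)%N -> V (A i j).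
Proof. by rewrite UTT_unitsE => -[_ [_ VA]] ij; exact: VA. Qed.

(** Since the identity is a unit, this contains the fact that a matrix with a
    one-sided inverse in the monoid is a unit. *)
Lemma face_UTT_units : face mulmx (UTT T) (@UTT_units S n T).
Proof.
move=> A B TA TB; rewrite UTT_unitsE => -[_ FAB].
have [FA FB] := face_unit_at (fun _ _ _ _ => I) TA TB FAB.
by split; split.
Qed.

(** * Generation *)

(** The sets of [t] with [Amx i t] in a semigroup [H] and of [s] with
    [Emx i j s] in [H] are closed under product and sum respectively, so it
    suffices to check the generators of [T] and of [S]. *)
Lemma UTT_generates (X : set 'M[S]_n) (Omega Theta : set S) :
  generates mulmx (UTT_units T) X -> Omega_generates T Omega ->
  Theta_generates T Theta ->
  generates mulmx (UTT T) (X `|` Eset Omega `|` Aset Theta).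
Proof.
move=> genX genOmega genTheta; apply: generatesP.
- exact: UTT_subsemigroup.
- move=> A [[/(generates_subset genX)[]//|]|].
    by move=> [i [j [w [ij _ ->]]]]; exact: Emx_UTT.
  move=> [i [t [Tht ->]]].
  by apply: Amx_UTT; apply: (generates_subset genTheta); left.
move=> H subH ZH A TA.
have unitsH : UTT_units T `<=` H.
  by apply: (generates_sub genX) => // B XB; apply: ZH; left; left.
have AH i t : T t -> H (Amx i t).
  suff: T `<=` [set t | H (Amx i t)] by apply.
  apply: (generates_sub genTheta) => [a b Ha Hb|a [Tha|Ua]] /=.
  - by rewrite AmxM; exact: subH.
  - by apply: ZH; right; exists i, a.
  - by apply: unitsH; exact: Amx_units.
have EH i j s : (i < j)%N -> H (Emx i j s).
  move=> ij; suff: setT `<=` [set s | H (Emx i j s)] by apply.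
  apply: (generates_sub genOmega) => [a b Ha Hb|_ [u Uu [w Ow <-]]] /=.
    by rewrite EmxD //; exact: subH.
  have [Tu [v [Tv uv _]]] := Uu.
  rewrite -(conj_Emx w ij uv); apply: (subH); last exact: AH.
  apply: (subH); first exact: AH.
  case: Ow => [Ow|Vw]; last by apply: unitsH; exact: Emx_units.
  by apply: ZH; left; right; exists i, j, w.
apply: elementary_factorisation => // [||i|i j ij].
- by apply: unitsH; exact: scalar1_units.
- exact: TA.1.
- by apply: AH; exact: TA.2.
- exact: EH.
Qed.

(** * The three kinds of members of a generating set *)

(** Off-diagonal entries are left free: they never contribute to the diagonal
    of a product. *)
Definition diag_part (Y : set 'M[S]_n) i : set 'M[S]_n :=
  [set A | [/\ Y A, forall k, k <> i -> U T (A k k) & ~ U T (A i i)]].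

Definition off_part (Y : set 'M[S]_n) i j : set 'M[S]_n :=
  [set A | [/\ Y A, forall k, U T (A k k),
     forall p q, (p < q)%N -> (p, q) <> (i, j) -> V (A p q) & ~ V (A i j)]].

Section GeneratingSet.
Variable Y : set 'M[S]_n.
Hypothesis Y_gen : generates mulmx (UTT T) Y.

(** Any factorisation of a unit involves only units. *)
Lemma units_part_generates : generates mulmx (UTT_units T) (Y `&` UTT_units T).
Proof.
apply: generatesP => [||H subH YH]; first exact: UTT_units_subsemigroup.
  by move=> A [].
have ind := face_ind (P := H) Y_gen face_UTT_units.
move=> A uA; apply: ind uA.1 uA => [B YB uB|B C _ _ _ _ HB HC].
  exact: YH.
exact: subH.
Qed.

(** Factor [Amx i t] over [Y] inside the face of matrices with unit diagonal
    entries away from [i], and read the [(i, i)] entries: those that are not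
    units come from [diag_part Y i]. *)
Lemma diag_part_generates i :
  Theta_generates T ((fun A : 'M[S]_n => A i i) @` diag_part Y i).
Proof.
have YT := generates_subset Y_gen.
apply: generatesP => [||H subH YH]; first exact: T_submonoid.2.
  move=> t [[A [/YT[_ TA] _ _] <-]|[]//]; exact: TA.
have faceF : face mulmx (UTT T) (unit_at [set k | k <> i] (fun _ _ => False)).
  by apply: face_unit_at.
have ind := face_ind (P := fun A => H (A i i)) Y_gen faceF.
move=> t Tt; have -> : t = (Amx i t : 'M[S]_n) i i by rewrite AmxE !eqxx.
apply: ind; last 2 first.
- exact: Amx_UTT.
- split=> // k /eqP ki; rewrite AmxE eqxx (negPf ki); exact: U1.
- move=> A YA [UA _]; apply: YH.
  by have [UAi|nUAi] := pselect (U T (A i i)); [right | left; exists A].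
- move=> A B TA TB _ _ HA HB.
  by rewrite (mulmx_diag _ TA.1 TB.1); exact: subH.
Qed.

(** Factor [Emx i j s] over [Y] inside the face where every place except
    [(i, j)] looks like that of a unit.  In the [(i, j)] entry of a product of
    such matrices, every path from [i] to [j] with an intermediate vertex
    contributes an element of [V]; what remains is a combination of the
    [(i, j)] entries of the factors with coefficients in [U T]. *)
Lemma off_part_generates i j : (i < j)%N ->
  Omega_generates T ((fun A : 'M[S]_n => A i j) @` off_part Y i j).
Proof.
move=> ij; have neij : i != j by rewrite -val_eqE ltn_eqF.
apply: generatesP => // H subH YH.
set Om := image _ _ in YH *.
have VH x : V x -> H x.
  move=> Vx; apply: YH; exists 1; first exact: U1.
  by exists x; [right | rewrite mul1r].
have faceF : face mulmx (UTT T) (unit_at setT (fun p q => (p, q) <> (i, j))).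
  by apply: face_unit_at.
(* Quantifying over [u] makes the induction hypothesis stable under
   multiplication by the diagonal entries of the other factor. *)
pose P (A : 'M[S]_n) := forall u, U T u -> H (u * A i j).
have ind := face_ind (P := P) Y_gen faceF.
move=> s _; have -> : s = 1 * (Emx i j s : 'M[S]_n) i j.
  by rewrite mul1r EmxE (negPf neij) !eqxx.
apply: ind (U1 T_submonoid); last 2 first.
- exact: Emx_UTT.
- split=> [k _|p q pq pqij]; rewrite EmxE ?eqxx; first exact: U1.
  rewrite -val_eqE ltn_eqF //; case: eqP => [pi|_]; last exact: V0.
  by case: eqP => [qj|_]; [rewrite pi qj in pqij | exact: V0].
- move=> A YA [UA VA] u Uu; apply: YH; exists u => //; exists (A i j) => //.
  have [VAij|nVAij] := pselect (V (A i j)); [by right | left].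
  by exists A => //; split=> // k; exact: UA.
- move=> A B [UTA TA] [UTB TB] [UA VA] [UB VB] PA PB u Uu.
  (* Split off the two summands that pass through [i] and [j]. *)
  rewrite mxE (bigD1 i) //= (bigD1 j) 1?eq_sym //= addrA mulrDr.
  apply: (subH).
    rewrite mulrDr; apply: subH.
      by rewrite mulrA; apply: PB; apply: U_mul => //; exact: UA.
    by rewrite [A i j * _]mulrC mulrA; apply: PA; apply: U_mul => //; exact: UB.
  apply: VH; apply: V_mull; apply: V_sum => k /andP[ki kj].
  have [lt_ki|lt_ik|/val_inj kE] := ltngtP k i; last by rewrite kE eqxx in ki.
    by rewrite UTA // mul0r; exact: V0.
  by apply: V_mulr; apply: VA => // -[kE]; rewrite kE eqxx in kj.
Qed.

End GeneratingSet.

(** * Minimality *)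

(** The proposed generators are a union of families indexed like the disjoint
    parts of [Y], and minimality compares each family with its part. *)
Lemma minimal_card_le (X Y : set 'M[S]_n) (Omega Theta : set S) :
  minimal_with (generates mulmx (UTT_units T)) X ->
  minimal_with (Omega_generates T) Omega ->
  minimal_with (Theta_generates T) Theta ->
  generates mulmx (UTT T) Y ->
  (X `|` Eset Omega `|` Aset Theta #<= Y)%card.
Proof.
move=> [_ minX] [_ minOmega] [_ minTheta] genY.
pose I : Type := (unit + 'I_n + 'I_n * 'I_n)%type.
(* [inl (inl tt)] stands for the units, [inl (inr i)] for the diagonal place
   [i], [inr (i, j)] for the place [(i, j)] above the diagonal. *)
pose D : set I :=
  [set k : I | if k is inr p then (p.1 < p.2)%N : Prop else True].
pose Z (k : I) : set 'M[S]_n := match k with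
  | inl (inl _) => X
  | inl (inr i) => Amx i @` Theta
  | inr (i, j) => Emx i j @` Omega
  end.
pose W (k : I) : set 'M[S]_n := match k with
  | inl (inl _) => Y `&` UTT_units T
  | inl (inr i) => diag_part Y i
  | inr (i, j) => off_part Y i j
  end.
have subZ : X `|` Eset Omega `|` Aset Theta `<=` \bigcup_(k in D) Z k.
  move=> A [[XA|[i [j [w [ij Ow ->]]]]]|[i [t [Tht ->]]]].
  - by exists (inl (inl tt)).
  - by exists (inr (i, j)) => //; exists w.
  - by exists (inl (inr i)) => //; exists t.
have subW : \bigcup_(k in D) W k `<=` Y.
  by move=> A [[[_|i]|[i j]] _] [].
apply: card_le_trans (subset_card_le subZ) _.
apply: card_le_trans (subset_card_le subW).
apply: card_le_bigcup => [|[[[]|i]|[i j]] Dk].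
- move=> [[[]|i]|[i j]] [[[]|i']|[i' j']] /= Dk Dk' [A []] //.
  + by move=> [_ uA] [_ _ []]; exact: unit_diag.
  + by move=> [_ uA] [_ _ _ []]; exact: unit_off.
  + by move=> [_ _ nU] [_ uA]; case: nU; exact: unit_diag.
  + move=> [_ UA nU] [_ UA' nU']; congr (inl (inr _)).
    by apply: contrapT => /nesym /UA.
  + by move=> [_ _ nU] [_ UA _ _]; case: nU; exact: UA.
  + by move=> [_ _ _ nV] [_ uA]; case: nV; exact: unit_off.
  + by move=> [_ UA _ _] [_ _ []].
  + move=> [_ _ VA nV] [_ _ VA' nV']; congr inr.
    by apply: contrapT => /nesym; exact: (contra_not (VA _ _ Dk')).
- exact/minX/units_part_generates.
- apply: card_le_trans (card_image_le _ _) _.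
  apply: card_le_trans (card_image_le (fun A : 'M[S]_n => A i i) _).
  exact/minTheta/diag_part_generates.
- apply: card_le_trans (card_image_le _ _) _.
  apply: card_le_trans (card_image_le (fun A : 'M[S]_n => A i j) _).
  exact/minOmega/off_part_generates.
Qed.

(** * Irredundance *)

(** [V] is already among the additive generators, so elements of [V] could be
    dropped from [Omega]; likewise below for [U T] and [Theta]. *)
Lemma irredundant_Omega_V Omega w :
  irredundant_with (Omega_generates T) Omega -> Omega w -> ~ V w.
Proof.
move=> [genO irrO] Ow Vw; apply: (irrO (Omega `\` V)).
  by split=> [x []//|/(_ w Ow)[]].
by rewrite /Omega_generates setUDl setDv setD0.
Qed.

Lemma irredundant_Theta_U Theta t :
  irredundant_with (Theta_generates T) Theta -> Theta t -> ~ U T t.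
Proof.
move=> [genT irrT] Tt Ut; apply: (irrT (Theta `\` U T)).
  by split=> [x []//|/(_ t Tt)[]].
by rewrite /Theta_generates setUDl setDv setD0.
Qed.

(** If the generators without [x] still generated, the part of them matching
    the family of [x] would be a generating subset of that family without the
    element that [x] comes from. *)
Lemma irredundant_UTT_generating (X : set 'M[S]_n) (Omega Theta : set S) :
  irredundant_with (generates mulmx (UTT_units T)) X ->
  irredundant_with (Omega_generates T) Omega ->
  irredundant_with (Theta_generates T) Theta ->
  irredundant_generating mulmx (UTT T) (X `|` Eset Omega `|` Aset Theta).
Proof.
move=> irrX irrOmega irrTheta.
have nV := irredundant_Omega_V irrOmega.
have nU := irredundant_Theta_U irrTheta.
split; first exact: UTT_generates irrX.1 irrOmega.1 irrTheta.1.
set Z := _ `|` _; move=> x Zx gen.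
have XU A : X A -> UTT_units T A by exact: (generates_subset irrX.1).
have EmxEE i j w : (i < j)%N -> (Emx i j w : 'M[S]_n) i j = w.
  by move=> ij; rewrite EmxE -val_eqE ltn_eqF // !eqxx.
have AmxEE i t : (Amx i t : 'M[S]_n) i i = t by rewrite AmxE !eqxx.
case: Zx => [[Xx|[i [j [w [ij Ow xE]]]]]|[i [t [Tht xE]]]].
- apply: irrX.2 (units_part_generates gen).
  split=> [A [[[[XA|[i [j [w [ij Ow ->]]]]]|[i [t [Tht ->]]]] nx] uA]|sub] //.
  + by case: (nV _ Ow); rewrite -(EmxEE i j w ij); exact: unit_off.
  + by case: (nU _ Tht); rewrite -(AmxEE i t); exact: unit_diag.
  + by case: (sub x Xx) => -[_ +] _; exact.
- have val A : off_part (Z `\ x) i j A -> exists2 w', Omega w' & A = Emx i j w'.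
    move=> [[[[XA|[p [q [w' [pq Ow' ->]]]]]|[p [t [Tht ->]]]] nx] UA VA nVA].
    + by case: nVA; apply: unit_off => //; exact: XU.
    + move: nVA; rewrite EmxE -val_eqE ltn_eqF //.
      case: eqP => [<-|_] /=; last by case; exact: V0.
      by case: eqP => [<-|_]; [exists w' | case; exact: V0].
    + by case: nVA; rewrite AmxE -val_eqE ltn_eqF //; exact: V0.
  apply: irrOmega.2 (off_part_generates gen ij).
  split=> [_ [A /val[w' Ow' ->] <-]|sub]; first by rewrite EmxEE.
  have [A offA Aw] := sub w Ow; have [w' _ AE] := val A offA.
  have [[_ nx] _ _ _] := offA; apply: nx.
  by rewrite /= xE AE -Aw AE EmxEE.
- have val A : diag_part (Z `\ x) i A -> exists2 t', Theta t' & A = Amx i t'.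
    move=> [[[[XA|[p [q [w [pq Ow ->]]]]]|[p [t' [Tht' ->]]]] nx] UA nUA].
    + by case: nUA; apply: unit_diag => //; exact: XU.
    + by case: nUA; rewrite EmxE eqxx; exact: U1.
    + move: nUA; rewrite AmxE eqxx; case: eqP => [->|_]; first by exists t'.
      by case; exact: U1.
  apply: irrTheta.2 (diag_part_generates gen i).
  split=> [_ [A /val[t' Tht' ->] <-]|sub]; first by rewrite AmxEE.
  have [A diagA At] := sub t Tht; have [t' _ AE] := val A diagA.
  have [[_ nx] _ _] := diagA; apply: nx.
  by rewrite /= xE AE -At AE AmxEE.
Qed.

End Triangular.

Theorem theorem3p2 (n : nat) (n_gt0 : (0 < n)%N) (S : comPzSemiRingType)
    (T : set S) (T_submonoid : submonoid T)
    (X : set 'M[S]_n) (Omega Theta : set S)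
    (X_gen : generates mulmx (UTT_units T) X)
    (Omega_gen : Omega_generates T Omega)
    (Theta_gen : Theta_generates T Theta) :
  [/\ generates mulmx (UTT T) (X `|` Eset Omega `|` Aset Theta),
      minimal_with (generates mulmx (UTT_units T)) X ->
      minimal_with (Omega_generates T) Omega ->
      minimal_with (Theta_generates T) Theta ->
      minimal_generating mulmx (UTT T) (X `|` Eset Omega `|` Aset Theta)
    & irredundant_with (generates mulmx (UTT_units T)) X ->
      irredundant_with (Omega_generates T) Omega ->
      irredundant_with (Theta_generates T) Theta ->
      irredundant_generating mulmx (UTT T) (X `|` Eset Omega `|` Aset Theta)].
Proof.
split=> [|minX minOmega minTheta|]; first exact: UTT_generates.
  split; first exact: UTT_generates.
  by move=> Y; exact: minimal_card_le.
exact: irredundant_UTT_generating.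
Qed.
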